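(* Let $d\ge2$ and $0<\alpha<1$. For every $\epsilon>0$ and every integer-valued function $p\mapsto K=K(p)$ on $(0,1)$ satisfying $K(p)<\dfrac{1}{p^{\alpha-\epsilon}}$, it holds that $$\lim_{p\to 0}\mathbb{P}_p\Big(\bigcup_{v\in\mathbb{Z}^d}\{\omega\in\Omega:\ \mu_\alpha(S_v(\omega))=1 \text{ on } G_K\}\Big)=0.$$
   Context: Fix $d\ge2$. For an integer $K$, $G_K=(\mathbb{Z}^d,\mathbb{E}_K)$ is the graph with vertex set $\mathbb{Z}^d$ in which $x,y$ are joined by an edge iff there is $i\in\{1,\dots,d\}$ with $0<|x_i-y_i|\le K$ and $x_j=y_j$ for all $j\ne i$. Site percolation: $\Omega=\{0,1\}^{\mathbb{Z}^d}$ with the $\sigma$-algebra generated by cylinder sets, and for $p\in(0,1)$, $\mathbb{P}_p$ is the product measure under which the coordinates $X(v)=X(\omega,v)$, $v\in\mathbb{Z}^d$, are i.i.d. Bernoulli with $\mathbb{P}_p(X(v)=1)=p$, $\mathbb{P}_p(X(v)=0)=1-p$. Words: $\Xi=\{0,1\}^{\mathbb{N}}$ with $\mathbb{N}=\{1,2,\dots\}$; elements $\xi=(\xi_1,\xi_2,\dots)$ are called words. A word $\xi$ is seen in $\omega$ from $v$ on $G_K$ if there is an infinite self-avoiding path $v=v_0,v_1,v_2,\dots$ in $G_K$ (all $v_i$ distinct, consecutive vertices joined by an edge of $G_K$) such that $X(\omega,v_i)=\xi_i$ for all $i\ge1$ (the state of $v_0=v$ is irrelevant). $S_v(\omega)$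 denotes the set of words $\xi\in\Xi$ seen in $\omega$ from $v$ on $G_K$. $\mu_\alpha$ is the product probability measure on $\Xi$ (with the cylinder $\sigma$-algebra) under which the digits $\xi_1,\xi_2,\dots$ are i.i.d. Bernoulli with $\mu_\alpha(\xi_n=1)=\alpha$. ''$\mu_\alpha(S_v(\omega))=1$ on $G_K$'' means that the set $S_v(\omega)$, computed with the graph $G_K$, has $\mu_\alpha$-measure $1$. *)

(* Defs.v *)
From HB Require Import structures.
From mathcomp Require Import all_boot all_order all_algebra.
From mathcomp Require Import all_classical all_reals all_analysis.

Set Implicit Arguments.
Unset Strict Implicit.
Unset Printing Implicit Defensive.

Import Order.TTheory GRing.Theory Num.Theory.
Import numFieldNormedType.Exports.
Local Open Scope classical_set_scope.
Local Open Scope ring_scope.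

(* The states 0 and 1 are represented by [false] and [true]. *)
Definition cylinders (I : choiceType) : set (set (I -> bool)) :=
  [set A | exists (s : seq I) (a : I -> bool),
    A = [set x | forall i, i \in s -> x i = a i]].

Definition states (I : choiceType) := g_sigma_algebraType (@cylinders I).

(* [P] is the law under which the coordinates are i.i.d. Bernoulli of
   parameter [q]; this determines [P], since [cylinders] is stable under
   intersection up to the empty set. *)
Definition is_bernoulli_product (R : realType) (I : choiceType) (q : R)
    (P : probability (states I) R) : Prop :=
  forall (s : seq I) (B : I -> set bool), uniq s ->
    P [set x | forall i, i \in s -> B i (x i)] =
    (\prod_(i <- s) bernoulli_prob q (B i))%E.

Definition config (d : nat) := states 'rV[int]_d.

(* Words are indexed from 0: [xi n] is the digit usually written xi_(n+1). *)
Definition word := states nat.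

Definition edge (d : nat) (K : int) (x y : 'rV[int]_d) : Prop :=
  exists i : 'I_d, 0 < `|x 0 i - y 0 i| <= K /\
    forall j : 'I_d, j != i -> x 0 j = y 0 j.

Definition seen_words (d : nat) (K : int) (v : 'rV[int]_d) (w : config d) :
    set word :=
  [set xi | exists path : nat -> 'rV[int]_d,
    [/\ path 0%N = v, injective path,
        forall n, edge K (path n) (path n.+1) &
        forall n, w (path n.+1) = xi n]].

(* Main.v *)
(** A vertex has at most [2 d K] neighbours, so by a union bound over walks the
    word [1 1 ... 1] of length [n] is seen from [v] with probability at most
    [(2 d K p)^n]. Since [alpha < 1], [K p] tends to [0] with [p], and for small
    [p] almost surely no vertex sees all finite words. On the other hand
    König's lemma shows that the set of words seen from [v] is closed, hence it
    has full [mu_alpha]-measure only when it contains every word. The same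
    description by finite prefixes makes the event measurable, which is needed
    because a measure takes arbitrary values on non-measurable sets. *)

Require Import Defs.
From mathcomp Require Import all_boot all_order all_algebra.
From mathcomp Require Import all_classical all_reals all_analysis.
From mathcomp Require Import lra.

Import Order.TTheory GRing.Theory Num.Theory.
Import numFieldNormedType.Exports.
Local Open Scope classical_set_scope.
Local Open Scope ring_scope.

(** * König's lemma for finite sequences *)

(** A sequence with extensions in [Q] of every length keeps this property after adding a suitable
    letter, since only the finitely many letters in [nb s] compete. Iterating the choice gives
    [f]. *)
Lemma koenig (T : eqType) (nb : seq T -> seq T) (Q : seq T -> Prop) :
  (forall s t, Q (s ++ t) -> Q s) ->
  (forall s x, Q (rcons s x) -> x \in nb s) ->
  (forall n, exists s, size s = n /\ Q s) ->
  exists f : nat -> T, forall n, Q (mkseq f n).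
Proof.
move=> Qpre Qnb Qex.
pose good s := forall n, exists t, size t = n /\ Q (s ++ t).
have good0 : good [::] by [].
have goodS s : good s -> exists x, good (rcons s x).
  move=> gs; apply: contrapT => /forallNP nx.
  have /choice[N HN] : forall x, exists n, ~ exists t,
      size t = n /\ Q (rcons s x ++ t).
    by move=> x; apply/existsNP; exact: nx.
  (* If each letter [x] failed at length [N x], an extension longer than every [N x] with [x] in
     [nb s], once truncated, would refute the failure of its own first letter. The successor makes
     room for that letter. *)
  have [[|x t] [//= [st] Qt]] := gs (\max_(x <- nb s) N x).+1.
  rewrite -cat_rcons in Qt.
  apply: (HN x); exists (take (N x) t); split.
    rewrite size_takel// st; apply: leq_bigmax_seq => //.
    exact: Qnb (Qpre _ _ Qt).
  by move: Qt; rewrite -{1}(cat_take_drop (N x) t) catA => /Qpre.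
(* [x0] serves as the value of [g] at sequences that are not good. *)
have [x0 _] := goodS _ good0.
have /choice[g Hg] : forall s, exists x, good s -> good (rcons s x).
  move=> s; have [/goodS[x gx]|ngs] := pselect (good s); first by exists x.
  by exists x0.
pose pre n := iter n (fun s => rcons s (g s)) [::].
exists (g \o pre) => n.
have -> : mkseq (g \o pre) n = pre n.
  by elim: n => [//|n IHn]; rewrite mkseqS IHn.
have /(_ 0%N)[t [_]] : good (pre n) by elim: n => // n IHn; exact: Hg.
exact: Qpre.
Qed.

(** * Enumeration of walks and neighbours *)

Section Walks.
Variables (T : eqType) (nb : T -> seq T).

(** The starting vertex is left out, its state being irrelevant to words. Revisits are allowed, so
    the count is an exact power. *)
Fixpoint walks (n : nat) (x : T) : seq (seq T) :=
  if n is m.+1 then flatten [seq [seq y :: s | s <- walks m y] | y <- nb x]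
  else [:: [::]].

Lemma mem_walks (e : rel T) (x : T) (s : seq T) :
  (forall x y, e x y -> y \in nb x) -> path e x s -> s \in walks (size s) x.
Proof.
move=> enb; elim: s x => [//|y s IHs] x /= /andP[exy ys].
apply/flattenP; exists [seq y :: t | t <- walks (size s) y].
  by apply/mapP; exists y => //; exact: enb.
by apply: map_f; exact: IHs.
Qed.

Lemma size_walks (c n : nat) (x : T) :
  (forall x, size (nb x) = c) -> size (walks n x) = (c ^ n)%N.
Proof.
move=> nbc; elim: n x => [//|n IHn] x /=.
rewrite size_flatten /shape -map_comp.
rewrite sumnE big_map (eq_bigr (fun=> (c ^ n)%N)); last first.
  by move=> y _ /=; rewrite size_map IHn.
by rewrite big_const_seq count_predT iter_addn_0 nbc expnS mulnC.
Qed.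

End Walks.

(** A negative [K] gives no edges, just as [K = 0]. *)
Definition range_nat (K : int) : nat := if K is Posz n then n else 0%N.

Definition neighbours (d : nat) (K : int) (x : 'rV[int]_d) : seq 'rV[int]_d :=
  [seq x + k *: delta_mx 0 i | i <- enum 'I_d,
     k <- map (fun n => n.+1%:Z) (iota 0 (range_nat K)) ++
          map (fun n => - n.+1%:Z) (iota 0 (range_nat K))].

Lemma size_neighbours (d : nat) (K : int) (x : 'rV[int]_d) :
  size (neighbours d K x) = (d * (range_nat K).*2)%N.
Proof.
by rewrite size_allpairs size_cat !size_map size_iota addnn -enumT size_enum_ord.
Qed.

Lemma edge_neighbours (d : nat) (K : int) (x y : 'rV[int]_d) :
  edge K x y -> y \in neighbours d K x.
Proof.
move=> [i [/andP[xy0 xyK] xyE]].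
have yE : y = x + (y 0 i - x 0 i) *: delta_mx 0 i.
  apply/rowP => j; rewrite !mxE eqxx/=.
  have [->|ji] := eqVneq j i; first by rewrite mulr1 addrC subrK.
  by rewrite mulr0 addr0 xyE.
rewrite yE; apply/allpairsP; exists (i, y 0 i - x 0 i) => /=; split => //.
  by rewrite mem_enum.
rewrite distrC in xy0 xyK; move: (y 0 i - x 0 i) xy0 xyK => k k0 kK.
rewrite mem_cat; apply/orP.
have KE : K = (range_nat K)%:Z.
  by case: K kK => [//|n] kn; have := lt_le_trans k0 kn.
case: k k0 kK => [[//|n]|n] _; rewrite KE => nK; [left|right].
  by apply/mapP; exists n => //; rewrite mem_iota.
by apply/mapP; exists n; rewrite ?NegzE// mem_iota.
Qed.

(** * Seen words through their finite prefixes *)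

Section Seen.
Variables (d : nat) (K : int).
Implicit Types (v : 'rV[int]_d) (w : config d) (a : seq bool).

Definition is_walk v (s : seq 'rV[int]_d) : bool :=
  path (fun x y => `[< edge K x y >]) v s && uniq (v :: s).

Definition seen_prefix v a : set (config d) :=
  [set w | exists2 s, is_walk v s & map w s = a].

(** The converse is compactness: walks seeing longer and longer prefixes need not extend one
    another, but the graph is locally finite, so [koenig] yields an infinite path. *)
Lemma seen_wordsP v w (xi : word) :
  seen_words K v w xi <-> forall n, seen_prefix v (mkseq xi n) w.
Proof.
split.
  move=> [path [path0 pinj pedge pxi]] n.
  exists (mkseq (fun i => path i.+1) n); last first.
    by rewrite -map_comp; apply: eq_map => i /=.
  have vE : v :: mkseq (fun i => path i.+1) n = mkseq path n.+1.
    by rewrite /mkseq /= path0 (iotaDl 1 0) -map_comp.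
  rewrite /is_walk; apply/andP; split.
    apply/(pathP v) => i; rewrite size_mkseq => ilt.
    by rewrite vE !nth_mkseq//; [apply/asboolP | rewrite ltnS ltnW].
  by rewrite vE map_inj_uniq// iota_uniq.
move=> seen.
pose Q s := is_walk v s /\ map w s = mkseq xi (size s).
have [||n|f Qf] := @koenig _ (fun s => neighbours d K (last v s)) Q.
- move=> s t [/andP[]]; rewrite cat_path -cat_cons cat_uniq.
  move=> /andP[ps _] /andP[us _] wst; split; first by rewrite /is_walk ps.
  move: wst; rewrite map_cat size_cat /mkseq iotaD map_cat => /eqP.
  by rewrite eqseq_cat ?size_map ?size_iota// => /andP[/eqP].
- move=> s x [/andP[]]; rewrite rcons_path => /andP[_ /asboolP + _ _].
  exact: edge_neighbours.
- have [s ws wE] := seen n; exists s.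
  have sn : size s = n by rewrite -(size_map w) wE size_mkseq.
  by rewrite /Q sn.
(* [f] lists the vertices after [v], hence the shift by one. *)
exists (fun n => if n is m.+1 then f m else v).
have vE n : v :: mkseq f n = mkseq (fun n => if n is m.+1 then f m else v) n.+1.
  by rewrite /mkseq /= (iotaDl 1 0) -map_comp.
split=> //.
(* Both indices occur in the self-avoiding walk of [maxn i j] steps. *)
- move=> i j ij; have [/andP[_]] := Qf (maxn i j).
  rewrite vE => /mkseq_uniqP inj _; apply: (inj i j) => //.
    by rewrite inE ltnS leq_maxl.
  by rewrite inE ltnS leq_maxr.
- move=> n; have [/andP[/(pathP v)/(_ n)+ _] _] := Qf n.+1.
  rewrite size_mkseq => /(_ (ltnSn n))/asboolP.
  by rewrite vE !nth_mkseq.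
- move=> n; have [_ /(congr1 (fun s => nth false s n))] := Qf n.+1.
  by rewrite size_mkseq (nth_map v) ?size_mkseq// !nth_mkseq.
Qed.

End Seen.

(** * Measurability of seeing a finite word *)

Lemma measurable_cylinder (I : choiceType) (s : seq I) (a : I -> bool) :
  measurable ([set x | forall i, i \in s -> x i = a i] : set (states I)).
Proof. by apply: sub_sigma_algebra; exists s, a. Qed.

Lemma measurable_countable_bigcap (disp : measure_display)
    (T : measurableType disp) (U : countType) (F : U -> set T) :
  (forall i, measurable (F i)) -> measurable (\bigcap_i F i).
Proof.
move=> mF; rewrite -[X in measurable X]setCK setC_bigcap; apply: measurableC.
by apply: countable_bigcupT_measurable => // i; exact: measurableC.
Qed.

Lemma measurable_states_seq (I : choiceType) (s : seq I) (a : seq bool) :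
  uniq s -> measurable ([set x | map x s = a] : set (states I)).
Proof.
move=> us; have [sa|sa] := eqVneq (size s) (size a); last first.
  rewrite (_ : [set x | _] = set0) //; apply/seteqP; split => // x /= xa.
  by move: sa; rewrite -xa size_map eqxx.
(* As [s] has no repetitions, the value prescribed at [i] sits at position [index i s], and the set
   is a cylinder. *)
rewrite (_ : [set x | _] =
    [set x | forall i, i \in s -> x i = nth false a (index i s)]).
  exact: measurable_cylinder.
apply/seteqP; split => x /=.
  move=> <- i si; rewrite (nth_map i) ?index_mem//.
  by rewrite nth_index.
move=> xs; apply: (@eq_from_nth _ false); rewrite size_map// => i ilt.
case: s us sa xs ilt => [//|i0 s] us sa xs ilt.
by rewrite (nth_map i0)// xs ?mem_nth// index_uniq.
Qed.

Lemma measurable_seen_prefix (d : nat) (K : int) (v : 'rV[int]_d) a :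
  measurable (seen_prefix d K v a).
Proof.
(* There are countably many finite sequences of vertices. *)
rewrite (_ : seen_prefix d K v a = \bigcup_(s : seq 'rV[int]_d)
    [set w | is_walk d K v s /\ map w s = a]); last first.
  by apply/seteqP; split => w [s ws wa]; exists s => //; case: wa.
apply: countable_bigcupT_measurable => // s.
have [ws|nws] := boolP (is_walk d K v s).
  rewrite (_ : [set w | _] = [set w : config d | map w s = a]).
    by apply: measurable_states_seq; case/andP: ws => _ /=/andP[].
  by apply/seteqP; split => w //= [].
by rewrite (_ : [set w | _] = set0)//; apply/seteqP; split => w //= [].
Qed.

(** * Full measure of the seen words *)

Lemma bernoulli_prob_set1 (R : realType) (q : R) (b : bool) : 0 <= q <= 1 ->
  bernoulli_prob q [set b] = (if b then q else 1 - q)%:E.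
Proof.
move=> q01; rewrite bernoulli_probE// !diracE.
by case: b; rewrite !classical_sets.in_set1/= mule0 mule1 ?adde0 ?add0e.
Qed.

Lemma bernoulli_product_seq (R : realType) (I : choiceType) (q : R)
    (P : probability (states I) R) (s : seq I) (a : I -> bool) :
  0 <= q <= 1 -> is_bernoulli_product q P -> uniq s ->
  P [set x | forall i, i \in s -> x i = a i] =
  (\prod_(i <- s) (if a i then q else 1 - q))%:E.
Proof.
move=> q01 hP us; have := hP s (fun i => [set a i]) us.
move=> ->; rewrite -prodEFin; apply: eq_bigr => i _.
exact: bernoulli_prob_set1.
Qed.

Section SeenAlmostAll.
Variables (R : realType) (alpha : R) (mu : probability word R).
Hypotheses (halpha : 0 < alpha < 1) (hmu : is_bernoulli_product alpha mu).
Variables (d : nat) (K : int).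

(** By [seen_wordsP] this is a countable intersection, over the length [n], of countable unions of
    cylinders. *)
Lemma measurable_seen_words v (w : config d) : measurable (seen_words K v w).
Proof.
rewrite (_ : seen_words K v w =
  \bigcap_n \bigcup_(a in [set a | seen_prefix d K v a w])
     [set xi : word | map xi (iota 0 n) = a]); last first.
  apply/seteqP; split => xi.
    by move=> /seen_wordsP sxi n _; exists (mkseq xi n) => //; exact: sxi.
  by move=> H; apply/seen_wordsP => n; have [a sa xa] := H n I; rewrite /mkseq xa.
apply: bigcapT_measurable => n; rewrite bigcup_mkcond.
apply: countable_bigcupT_measurable => // a; case: ifP => // _.
by apply: measurable_states_seq; exact: iota_uniq.
Qed.

(* [seen_words] is closed and cylinders have positive measure, so full
   measure forces every word to be seen. *)
Lemma seen_words_full v (w : config d) :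
  mu (seen_words K v w) = 1%E <-> forall a, seen_prefix d K v a w.
Proof.
split=> [mu1 a|seen]; last first.
  rewrite (_ : seen_words K v w = setT) ?probability_setT//.
  by apply/seteqP; split => // xi _; apply/seen_wordsP.
apply: contrapT => na.
(* [C] collects the words beginning with the unseen [a]. It misses every seen word, yet has positive
   measure because [alpha] and [1 - alpha] are positive. *)
pose C := [set xi : word | forall i, i \in iota 0 (size a) ->
                                     xi i = nth false a i].
have mC : measurable C by exact: measurable_cylinder.
have muC : (0 < mu C)%E.
  have /andP[a0 a1] := halpha.
  rewrite (@bernoulli_product_seq _ _ alpha)// ?iota_uniq ?(ltW a0) ?(ltW a1)//.
  rewrite lte_fin; apply: prodr_gt0 => i _.
  by case: ifP => // _; rewrite subr_gt0.
have sub : seen_words K v w `<=` ~` C.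
  move=> xi /seen_wordsP/(_ (size a)) + Cxi; rewrite (_ : mkseq _ _ = a)//.
  apply: (@eq_from_nth _ false); rewrite size_mkseq// => i ilt.
  by rewrite nth_mkseq// Cxi// mem_iota.
have : (mu (seen_words K v w) <= mu (~` C))%E.
  apply: le_measure => //; rewrite inE; last exact: measurableC.
  exact: measurable_seen_words.
rewrite mu1 probability_setC// leNgt => /negP; apply.
rewrite -(fineK (fin_num_measure mu _ mC)) in muC *.
by rewrite -EFinB lte_fin ltrBlDr ltrDl -lte_fin.
Qed.

(** [seen_words_full] turns the event into an intersection over the countably many finite words. *)
Lemma measurable_seen_full v :
  measurable [set w : config d | mu (seen_words K v w) = 1%E].
Proof.
rewrite (_ : [set w | _] = \bigcap_a seen_prefix d K v a).
  by apply: measurable_countable_bigcap => a; exact: measurable_seen_prefix.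
apply/seteqP; split => w /=; first by move=> /seen_words_full H a _; exact: H.
by move=> H; apply/seen_words_full => a; exact: H.
Qed.

End SeenAlmostAll.

(** * Union bound for words of ones *)

Lemma measure_bigsetU_le (disp : measure_display) (T : measurableType disp)
    (R : realType) (P : {measure set T -> \bar R}) (U : Type) (l : seq U)
    (F : U -> set T) (c : R) :
  (forall u, measurable (F u)) -> (forall u, (P (F u) <= c%:E)%E) ->
  (P (\big[setU/set0]_(u <- l) F u) <= ((size l)%:R * c)%:E)%E.
Proof.
move=> mF PF; elim: l => [|u l IHl].
  by rewrite big_nil measure0 mul0r.
rewrite big_cons; apply: le_trans (measureU2 _ _ _) _ => //.
  exact: bigsetU_measurable.
by rewrite /= -natr1 mulrDl mul1r addrC EFinD; exact: leeD.
Qed.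

Section AllOnes.
Variables (R : realType) (d : nat) (K : int) (p : R).
Variable P : probability (config d) R.
Hypotheses (hp : 0 < p < 1) (hP : is_bernoulli_product p P).

Lemma seen_prefix_ones_le v n :
  (P (seen_prefix d K v (nseq n true)) <=
     (((d * (range_nat K).*2)%:R * p) ^+ n)%:E)%E.
Proof.
have /andP[p0 p1] := hp.
(* Emptying [F s] for lists with repetitions or of the wrong length makes the bound [p ^+ n] valid
   for every [s]. No walk seeing the word is lost, as walks are self-avoiding. *)
pose F s := if uniq s && (size s == n)
  then [set w : config d | forall x, x \in s -> w x = true] else set0.
have mF s : measurable (F s).
  by rewrite /F; case: ifP => // _; exact: measurable_cylinder (fun=> true).
have PF s : (P (F s) <= (p ^+ n)%:E)%E.
  rewrite /F; case: ifP => [/andP[us /eqP <-]|_]; last first.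
    by rewrite measure0 lee_fin exprn_ge0// ltW.
  rewrite (@bernoulli_product_seq _ _ p P s (fun=> true))//; last first.
    by rewrite !ltW.
  by rewrite big_const_seq count_predT iter_mulr_1.
rewrite exprMn -natrX.
rewrite -(size_walks _ _ _ n v (size_neighbours d K)).
apply: le_trans (measure_bigsetU_le _ _ _ _ _ _ _ _ mF PF).
apply: le_measure; rewrite ?inE.
- exact: measurable_seen_prefix.
- exact: bigsetU_measurable.
move=> w [s /andP[ps /=/andP[_ us]] wE].
have sn : size s = n by rewrite -(size_map w) wE size_nseq.
rewrite -bigcup_seq; exists s.
  rewrite /= -sn; apply: mem_walks ps => x y /asboolP.
  exact: edge_neighbours.
rewrite /F us sn eqxx /= => x sx; apply/eqP.
have : w x \in map w s by exact: map_f.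
by rewrite wE mem_nseq => /andP[_].
Qed.

(** Seeing every finite word entails seeing [n] ones for each [n], and the bounds on these
    probabilities form a geometric sequence tending to 0. *)
Lemma seen_all_prefixes_null v : (d * (range_nat K).*2)%:R * p < 1 ->
  P (\bigcap_a seen_prefix d K v a) = 0%E.
Proof.
move=> lt1; have /andP[p0 _] := hp.
have c0 : 0 <= (d * (range_nat K).*2)%:R * p by rewrite mulr_ge0// ltW.
apply/eqP; rewrite -measure_le0.
apply: (@cvge_ge _ \oo _ _ (fun n => (((d * (range_nat K).*2)%:R * p) ^+ n)%:E)).
  near=> n; apply: le_trans (seen_prefix_ones_le v n).
  apply: le_measure; rewrite ?inE; last exact: bigcap_inf.
    by apply: measurable_countable_bigcap => a; exact: measurable_seen_prefix.
  exact: measurable_seen_prefix.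
apply: cvg_EFin; first by near=> n.
by apply: cvg_expr; rewrite ger0_norm.
Unshelve. all: by end_near. Qed.

End AllOnes.

(** * Countable unions and small [p] *)

Lemma measure_countable_bigcup0 (disp : measure_display)
    (T : measurableType disp) (R : realType) (P : {measure set T -> \bar R})
    (U : countType) (F : U -> set T) :
  (forall u, measurable (F u)) -> (forall u, P (F u) = 0%E) ->
  P (\bigcup_u F u) = 0%E.
Proof.
move=> mF PF; apply: measure_negligible.
  exact: countable_bigcupT_measurable.
(* Reindexing by natural numbers: those that code no element of [U] contribute the empty set. *)
rewrite (_ : \bigcup_u F u =
  \bigcup_n (if unpickle n is Some u then F u else set0)).
  apply: negligible_bigcup => n; case: unpickle => [u|]; last first.
    exact: negligible_set0.
  by exists (F u); split.
apply/seteqP; split => x.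
  by move=> [u _ Fu]; exists (pickle u) => //; rewrite pickleK.
by move=> [n _]; case: unpickle => // u Fu; exists u.
Qed.

(** The quantity is the mean number of open neighbours of a vertex. It is at most [2 d] times a
    power of [p] with exponent [1 - (alpha - eps) > 0]. *)
Lemma near0_open_degree_lt1 (R : realType) (d : nat) (alpha eps : R) (K : R -> int) :
  alpha < 1 -> 0 < eps ->
  (forall p : R, 0 < p < 1 -> (K p)%:~R < 1 / p `^ (alpha - eps)) ->
  \forall p \near 0^'+, (d * (range_nat (K p)).*2)%:R * p < 1.
Proof.
move=> a1 e0 hK.
have e'0 : 0 < 1 - (alpha - eps) by lra.
(* This threshold works because [2 d / (2 d + 1) < 1]; the added 1 keeps it positive even for
   [d = 0]. *)
have d0 : 0 < (d.*2.+1%:R : R)^-1 by rewrite invr_gt0.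
have /cvgr_lt/(_ _ d0) := powR_cvg0 e'0.
move=> small; near=> p.
have p0 : 0 < p by near: p; exact: nbhs_right_gt.
have p1 : p < 1 by near: p; exact: nbhs_right_lt.
have pd : p `^ (1 - (alpha - eps)) < (d.*2.+1%:R)^-1 by near: p.
have Kp : (range_nat (K p))%:R * p < (d.*2.+1%:R)^-1.
  apply: le_lt_trans pd; case: (K p) (hK p) => [n|n]/= hn; last first.
    by rewrite mul0r powR_ge0.
  have -> : p `^ (1 - (alpha - eps)) = p / p `^ (alpha - eps).
    by rewrite (@powRB _ p 1) ?powRr1 ?(ltW p0)// (gt_eqF p0) implybT.
  rewrite [leRHS]mulrC ler_pM2r// ltW//.
  by rewrite -[_^-1]mul1r; apply: hn; rewrite p0.
have -> : (d * (range_nat (K p)).*2)%:R * p = d.*2%:R * ((range_nat (K p))%:R * p).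
  by rewrite -doubleMr doubleMl natrM mulrA.
apply: (@le_lt_trans _ _ (d.*2%:R * d.*2.+1%:R^-1)).
  by rewrite ler_wpM2l// ltW.
by rewrite ltr_pdivrMr// mul1r ltr_nat.
Unshelve. all: by end_near. Qed.

Theorem theorem4 (R : realType) (d : nat) (hd : (2 <= d)%N)
    (alpha : R) (halpha : 0 < alpha < 1)
    (P : R -> probability (config d) R)
    (hP : forall p : R, 0 < p < 1 -> is_bernoulli_product p (P p))
    (mu : probability word R) (hmu : is_bernoulli_product alpha mu)
    (eps : R) (heps : 0 < eps) (K : R -> int)
    (hK : forall p : R, 0 < p < 1 -> (K p)%:~R < 1 / p `^ (alpha - eps)) :
  P p (\bigcup_(v : 'rV[int]_d)
         [set w : config d | mu (seen_words (K p) v w) = 1%E]) @[p --> 0^'+]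
    --> 0%E.
Proof.
have /andP[_ a1] := halpha.
(* For small [p] the probability is exactly 0: each vertex gives a null event, and there are
   countably many vertices. *)
apply: cvg_near_cst; near=> p.
have p01 : 0 < p < 1.
  by apply/andP; split; near: p; [exact: nbhs_right_gt | exact: nbhs_right_lt].
apply: measure_countable_bigcup0 => v.
  exact: (measurable_seen_full _ _ _ halpha hmu).
rewrite (_ : [set w | _] = \bigcap_a seen_prefix d (K p) v a).
  apply: (seen_all_prefixes_null _ _ _ _ _ p01 (hP p p01)).
  near: p; exact: (near0_open_degree_lt1 _ _ _ _ _ a1 heps hK).
apply/seteqP; split => w /=.
  by move=> /(seen_words_full _ _ _ halpha hmu) H a _.
by move=> H; apply/(seen_words_full _ _ _ halpha hmu) => a; exact: H.
Unshelve. all: by end_near. Qed.
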